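(* Consider the autonomous system $x_k = M x_{k-1} + w_k$, $y_k = H x_k + v_k$ described in the context, and assume it is uniformly completely observable and uniformly completely controllable. Let $\widehat P = \widehat X\widehat X^{T}$ ($\widehat X\in\mathbb R^{n\times n}$) be the unique positive semi-definite solution of the stable Riccati equation $$P = M X (I_n + X^{T}\Omega X)^{-1}X^{T}M^{T} + Q,\qquad P = XX^{T},$$ and set $\alpha = \sigma_n(\widehat X^{T}\Omega\widehat X)\ge 0$, $\beta = \sigma_1(\widehat X^{T}\Omega\widehat X)<\infty$ (smallest and largest singular values). (Upper bounds.) Let $1\le i\le p$ and suppose $\epsilon>0$ is such that $\frac{e^{2(\lambda_i+\epsilon)}}{1+\alpha}<1$; choose $N_{i,\epsilon}$ as in the context. Then for every eigenvector $v\in\mathbb C^n$ of $M^{T}$ associated to an eigenvalue $\mu_i$ with $|\mu_i| = e^{\lambda_i}$, $$v^{\mathrm H}\widehat P v \le \frac{v^{\mathrm H}Qv}{1-\frac{e^{2\lambda_i}}{1+\alpha}},$$ and for every $1\le j\le\kappa_i$, with $B^{i_j}$ the $i_j$-th backward Lyapunov vector, $$(B^{i_j})^{T}\widehat P B^{i_j} \le (B^{i_j})^{T}\Xi^{\alpha}_{N_{i,\epsilon}:0}B^{i_j} + \left(\frac{e^{2(\lambda_i+\epsilon)}}{1+\alpha}\right)^{N_{i,\epsilon}+1}\left(\frac{q_{\sup}}{1-\frac{e^{2(\lambda_i+\epsilon)}}{1+\alpha}}\right).$$ (Lower bounds.) For every $1\le i\le p$, every $\epsilon>0$ and associated $N_{i,\epsilon}$,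 every eigenvector $v$ of $M^{T}$ associated to an eigenvalue of modulus $e^{\lambda_i}$, and every $1\le j\le\kappa_i$, $$\frac{v^{\mathrm H}Qv}{1-\frac{e^{2\lambda_i}}{1+\beta}}\le v^{\mathrm H}\widehat P v$$ and $$(B^{i_j})^{T}\Xi^{\beta}_{N_{i,\epsilon}:0}B^{i_j} + \left(\frac{e^{2(\lambda_i-\epsilon)}}{1+\beta}\right)^{N_{i,\epsilon}+1}\left(\frac{q_{\inf}}{1-\frac{e^{2(\lambda_i-\epsilon)}}{1+\beta}}\right)\le (B^{i_j})^{T}\widehat P B^{i_j}.$$
   Context: Setting. $M\in\mathbb R^{n\times n}$ is invertible, $H\in\mathbb R^{d\times n}$ with $d\le n$; $w_k$, $v_k$ are mutually independent, mean-zero Gaussian white sequences with covariances $Q\in\mathbb R^{n\times n}$ and $R\in\mathbb R^{d\times d}$ respectively, where $0\le q_{\inf}I_n\le Q\le q_{\sup}I_n$ and $0<r_{\inf}I_d\le R\le r_{\sup}I_d$ for real constants $q_{\inf},q_{\sup},r_{\inf},r_{\sup}$. The order $B\le A$ on symmetric matrices means $A-B$ is positive semi-definite. $\Omega = H^{T}R^{-1}H$ is the precision matrix. $v^{\mathrm H}$ denotes the conjugate transpose (equal to $v^{T}$ for real $v$). Observability/controllability. For $j\le k$ put $\Phi_{k:j}=\sum_{l=j}^{k}(M^{k-l})^{-T}\Omega (M^{k-l})^{-1}$ and $\Upsilon_{k:j}=\sum_{l=j}^{k}M^{k-l}Q(M^{k-l})^{T}$. The system is uniformly completely observable if there are $N_\Phi,a,b>0$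 independent of $k$ with $0<aI_n\le\Phi_{k:k-N_\Phi}\le bI_n$ for all $k>N_\Phi$; uniformly completely controllable if there are $N_\Upsilon,a,b>0$ independent of $k$ with $0<aI_n\le\Upsilon_{k:k-N_\Upsilon}\le bI_n$ for all $k>N_\Upsilon$. Under both conditions it is classical that the stable Riccati equation has a unique positive semi-definite solution $\widehat P$. Weighted controllability matrix: for $\gamma\ge0$, $\Xi^{\gamma}_{k:j}=\sum_{l=j}^{k}\left(\frac{1}{1+\gamma}\right)^{k-l}M^{k-l}Q(M^{k-l})^{T}$. Lyapunov exponents and vectors. $\lambda_1>\dots>\lambda_p$ are the distinct Lyapunov exponents of $x_k=Mx_{k-1}$ with multiplicities $\kappa_1,\dots,\kappa_p$; equivalently, $e^{\lambda_1}>\dots>e^{\lambda_p}$ are the distinct moduli of the eigenvalues of $M$ (equivalently of $M^{T}$), and $\kappa_i$ is the number of eigenvalues of modulus $e^{\lambda_i}$ counted with algebraic multiplicity. The far-past operator is $W^-=\lim_{l\to\infty}[(M^{l})^{-T}(M^{l})^{-1}]^{1/(2l)}$, a symmetric positive definite matrix with distinct eigenvalues $e^{-\lambda_i}$ of multiplicity $\kappa_i$. The backward Lyapunov vectors $B^{i_j}$, $1\le i\le p$, $1\le j\le\kappa_i$, are any orthonormal eigenbasis of $W^-$ with $W^-B^{i_j}=e^{-\lambda_i}B^{i_j}$. The number $N_{i,\epsilon}$. For $\epsilon>0$, $N_{i,\epsilon}$ denotes a nonnegative integer such that for all $1\le j\le\kappa_i$ and all $l>N_{i,\epsilon}$, $-\epsilon<\frac1l\log\|(M^{T})^{l}B^{i_j}\|-\lambda_i<\epsilon$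 (Euclidean norm). Such a number always exists for time-invariant $M$. *)

(* Defs.v *)
From HB Require Import structures.
From mathcomp Require Export all_boot all_order all_algebra.
From mathcomp Require Export sesquilinear spectral.
From mathcomp Require Export complex.
From mathcomp Require Export all_classical all_reals all_analysis.

Export Order.TTheory GRing.Theory Num.Theory.
Export numFieldNormedType.Exports.

#[export] Set Implicit Arguments.
#[export] Unset Strict Implicit.
#[export] Unset Printing Implicit Defensive.

Local Open Scope classical_set_scope.
Local Open Scope complex_scope.
Local Open Scope sesquilinear_scope.
Local Open Scope ring_scope.

Section LinearAlgebra.
Variable R : realType.

(* The norm MathComp-Analysis puts on matrices is the sup norm. *)
Definition euclidean_norm (n : nat) (x : 'cV[R]_n) : R :=
  Num.sqrt ((x^T *m x) 0 0).

Definition qform (n : nat) (A : 'M[R]_n) (x : 'cV[R]_n) : R :=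
  (x^T *m A *m x) 0 0.

Definition psd (n : nat) (A : 'M[R]_n) : Prop :=
  A^T = A /\ forall x : 'cV[R]_n, 0 <= qform A x.

Definition loewner_le (n : nat) (B A : 'M[R]_n) : Prop := psd (A - B).

Definition cplx_mx (m n : nat) (A : 'M[R]_(m, n)) : 'M[R[i]]_(m, n) :=
  map_mx (real_complex R) A.

(* v^H A v, as a complex number; in the order of R[i], x <= y means that
   y - x is a nonnegative real. *)
Definition hform (n : nat) (A : 'M[R]_n) (v : 'cV[R[i]]_n) : R[i] :=
  (v ^t* *m cplx_mx A *m v) 0 0.

(* MathComp's eigenvalue and eigenspace are about row vectors. *)
Definition col_eigenvector (n : nat) (A : 'M[R]_n) (mu : R[i])
    (v : 'cV[R[i]]_n) : Prop :=
  v != 0 /\ cplx_mx A *m v = mu *: v.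

Definition singular_values (n : nat) (A : 'M[R]_n) : set R :=
  [set s | 0 <= s /\ eigenvalue (A^T *m A) (s ^+ 2)].

(* For n > 0 the set of singular values is finite and nonempty, so that these
   are its maximum sigma_1 and its minimum sigma_n. *)
Definition sigma_max (n : nat) (A : 'M[R]_n) : R := sup (singular_values A).
Definition sigma_min (n : nat) (A : 'M[R]_n) : R := inf (singular_values A).

(* A^(1/m), the unique positive semi-definite m-th root of a positive
   semi-definite A, for m > 0. *)
Definition psd_root (n m : nat) (A : 'M[R]_n) : 'M[R]_n :=
  xget 0 [set B : 'M[R]_n | psd B /\ B ^+ m = A].

End LinearAlgebra.

Section Filter.
Variable R : realType.

Definition precision (n d : nat) (H : 'M[R]_(d, n)) (Rv : 'M[R]_d) : 'M[R]_n :=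
  H^T *m invmx Rv *m H.

Definition observability (n : nat) (M Om : 'M[R]_n) (k j : nat) : 'M[R]_n :=
  \sum_(j <= l < k.+1)
    (invmx (M ^+ (k - l)))^T *m Om *m invmx (M ^+ (k - l)).

Definition controllability (n : nat) (M Q : 'M[R]_n) (k j : nat) : 'M[R]_n :=
  \sum_(j <= l < k.+1) M ^+ (k - l) *m Q *m (M ^+ (k - l))^T.

Definition weighted_controllability (n : nat) (M Q : 'M[R]_n) (g : R)
    (k j : nat) : 'M[R]_n :=
  \sum_(j <= l < k.+1)
    (1 / (1 + g)) ^+ (k - l) *: (M ^+ (k - l) *m Q *m (M ^+ (k - l))^T).

Definition uniformly_completely_observable (n : nat) (M Om : 'M[R]_n) : Prop :=
  exists (N : nat) (a b : R), [/\ (0 < N)%N, 0 < a, 0 < b &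
    forall k : nat, (N < k)%N ->
      loewner_le a%:M (observability M Om k (k - N)) /\
      loewner_le (observability M Om k (k - N)) b%:M].

Definition uniformly_completely_controllable (n : nat) (M Q : 'M[R]_n) : Prop :=
  exists (N : nat) (a b : R), [/\ (0 < N)%N, 0 < a, 0 < b &
    forall k : nat, (N < k)%N ->
      loewner_le a%:M (controllability M Q k (k - N)) /\
      loewner_le (controllability M Q k (k - N)) b%:M].

(* P is automatically positive semi-definite. The right-hand side depends on X
   only through X X^T, hence so does the property of being a solution. *)
Definition stable_riccati (n : nat) (M Om Q X P : 'M[R]_n) : Prop :=
  P = X *m X^T /\
  P = M *m X *m invmx (1%:M + X^T *m Om *m X) *m X^T *m M^T + Q.

End Filter.

Section Lyapunov.
Variable R : realType.

Definition lyapunov_exponent (n : nat) (M : 'M[R]_n) (l : R) : Prop :=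
  exists2 x : 'cV[R]_n, x != 0 &
    (k%:R^-1 * ln (euclidean_norm (M ^+ k *m x))) @[k --> \oo] --> l.

(* The list s enumerates the complex eigenvalues of M with their algebraic
   multiplicities. *)
Definition lyapunov_spectrum (n : nat) (M : 'M[R]_n) (p : nat)
    (lam : 'I_p -> R) (kappa : 'I_p -> nat) : Prop :=
  [/\ (forall i j : 'I_p, (i < j)%N -> lam j < lam i),
      (forall l : R, lyapunov_exponent M l <-> exists i : 'I_p, l = lam i) &
      exists s : seq R[i],
        char_poly (cplx_mx M) = \prod_(z <- s) ('X - z%:P) /\
        forall i : 'I_p,
          kappa i = count (fun z => `|z| == (expR (lam i))%:C) s].

Definition far_past (n : nat) (M : 'M[R]_n) : 'M[R]_n :=
  lim (psd_root (2 * l) ((invmx (M ^+ l))^T *m invmx (M ^+ l)) @[l --> \oo]).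

(* The kappa i add up to n, so that such an orthonormal family is a basis. *)
Definition backward_lyapunov_vectors (n : nat) (M : 'M[R]_n) (p : nat)
    (lam : 'I_p -> R) (kappa : 'I_p -> nat)
    (B : forall i : 'I_p, 'I_(kappa i) -> 'cV[R]_n) : Prop :=
  (forall a b : {i : 'I_p & 'I_(kappa i)},
     ((B (tag a) (tagged a))^T *m B (tag b) (tagged b)) 0 0 = (a == b)%:R) /\
  (forall (i : 'I_p) (j : 'I_(kappa i)),
     far_past M *m B i j = expR (- lam i) *: B i j).

Definition growth_threshold (n : nat) (M : 'M[R]_n) (k : nat)
    (b : 'I_k -> 'cV[R]_n) (lam eps : R) (N : nat) : Prop :=
  forall (j : 'I_k) (l : nat), (N < l)%N ->
    - eps < 1 / l%:R * ln (euclidean_norm (M^T ^+ l *m b j)) - lam < eps.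

End Lyapunov.

Section Noise.
Variables (R : realType) (disp : measure_display) (T : measurableType disp).
Variable P : probability T R.

(* Product rule over every finite subfamily. *)
Definition mutually_independent (I : eqType) (F : I -> set (set T)) : Prop :=
  forall (s : seq I) (E : I -> set T), uniq s ->
    (forall i : I, i \in s -> F i (E i)) ->
    P (\bigcap_(i in [set` s]) E i) = (\prod_(i <- s) P (E i))%E.

Definition generated_sigma_algebra (m : nat) (X : T -> 'cV[R]_m) :
    set (set T) :=
  <<s [set C | exists (i : 'I_m) (A : set R),
         measurable A /\ C = (fun t => X t i 0) @^-1` A] >>.

(* normal_prob m 0 is a junk value in the library, not the point mass at m. *)
Definition gaussian_law (m s : R) (A : set R) : \bar R :=
  if s == 0 then \d_m A else normal_prob m s A.

(* Degenerate Gaussian vectors are allowed. *)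
Definition gaussian_vector (m : nat) (X : T -> 'cV[R]_m) : Prop :=
  (forall i : 'I_m, measurable_fun setT (fun t => X t i 0)) /\
  forall u : 'cV[R]_m, exists mean s : R, forall A : set R, measurable A ->
    P ((fun t => (u^T *m X t) 0 0) @^-1` A) = gaussian_law mean s A.

Definition centered_gaussian (m : nat) (S : 'M[R]_m) (X : T -> 'cV[R]_m) :
    Prop :=
  [/\ gaussian_vector X,
      (forall i : 'I_m, ('E_P[fun t => X t i 0%R] = 0)%E) &
      forall i j : 'I_m,
        covariance P (fun t => X t i 0) (fun t => X t j 0) = (S i j)%:E].

Definition linear_gaussian_system (n d : nat) (M : 'M[R]_n) (H : 'M[R]_(d, n))
    (Q : 'M[R]_n) (Rv : 'M[R]_d) (x w : nat -> T -> 'cV[R]_n)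
    (y v : nat -> T -> 'cV[R]_d) : Prop :=
  [/\ (forall k t, x k.+1 t = M *m x k t + w k.+1 t),
      (forall k t, y k t = H *m x k t + v k t),
      (forall k, centered_gaussian Q (w k)),
      (forall k, centered_gaussian Rv (v k)) &
      mutually_independent (fun a : nat + nat =>
        match a with
        | inl k => generated_sigma_algebra (w k)
        | inr k => generated_sigma_algebra (v k)
        end)].

End Noise.

(* Main.v *)
Require Import Defs.
From mathcomp Require Import ring lra.

Local Open Scope classical_set_scope.
Local Open Scope complex_scope.
Local Open Scope sesquilinear_scope.
Local Open Scope ring_scope.

(** Put S = X^T Om X, a positive semi-definite matrix. By the spectral theorem
    (1 + S)^-1 lies between 1 / (1 + beta) and 1 / (1 + alpha)
    ([hform_resolvent]), where alpha and beta are the extreme singular values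
    of S. Sandwiching this between M X and X^T M^T turns the Riccati equation
    into two affine inequalities for the form of P ([riccati_bounds]):
    [[
      P(M^T u) / (1 + beta) + Q(u) <= P(u) <= P(M^T u) / (1 + alpha) + Q(u).
    ]]
    On an eigenvector u of M^T, P(M^T u) = |mu|^2 P(u), so that each
    inequality is a scalar one in P(u), and it is solved by [affine_upper] or
    [affine_lower].

    On a backward Lyapunov vector the inequalities are iterated K times. With
    c the weight 1 / (1 + alpha) or 1 / (1 + beta), this compares P(x) with
    the sum over m < K of c^m Q((M^T)^m x), up to a remainder
    c^K P((M^T)^K x). The terms m <= N make up the weighted controllability
    form. For m > N the growth of (M^T)^m x, squared, is controlled by
    exp (2 (lam +- eps)) ^ m, and Q by qsup or qinf, so that the other terms
    are controlled by a geometric series, which is summed by letting K tend to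
    infinity ([geometric_iter_upper], [geometric_iter_lower]). In the upper
    bound the remainder tends to 0, in the lower bound it is nonnegative and is
    dropped.

    In the lower bounds the ratio of the series may be at least 1. Then the
    denominator 1 - ratio is negative, or it is 0 and so is its inverse. The
    term divided by it is nonpositive, and the bound follows from P >= 0, or
    from the partial sum up to N. *)

(** * Real quadratic forms and Hermitian forms *)

Section Forms.
Variable R : realType.

Definition sqnorm (n : nat) (x : 'cV[R]_n) : R := (x^T *m x) 0 0.

Lemma sqnormE n (x : 'cV[R]_n) : sqnorm x = \sum_i x i 0 ^+ 2.
Proof.
by rewrite /sqnorm mxE; apply: eq_bigr => i _; rewrite mxE -expr2.
Qed.

Lemma sqnorm_ge0 n (x : 'cV[R]_n) : 0 <= sqnorm x.
Proof. by rewrite sqnormE sumr_ge0 // => i _; rewrite sqr_ge0. Qed.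

Lemma sqnorm_gt0 n (x : 'cV[R]_n) : x != 0 -> 0 < sqnorm x.
Proof.
move=> x0; rewrite lt_neqAle sqnorm_ge0 andbT eq_sym; apply: contraNneq x0.
rewrite sqnormE => /eqP.
rewrite psumr_eq0 => [/allP h|i _]; last exact: sqr_ge0.
apply/eqP/matrixP => i j; rewrite ord1 mxE; apply/eqP.
by rewrite -sqrf_eq0; apply: (h i); rewrite mem_index_enum.
Qed.

Lemma qformD n (A B : 'M[R]_n) x : qform (A + B) x = qform A x + qform B x.
Proof. by rewrite /qform mulmxDr mulmxDl mxE. Qed.

Lemma qformB n (A B : 'M[R]_n) x : qform (A - B) x = qform A x - qform B x.
Proof. by rewrite /qform mulmxBr mulmxBl !mxE. Qed.

Lemma qformZ n c (A : 'M[R]_n) x : qform (c *: A) x = c * qform A x.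
Proof. by rewrite /qform -scalemxAr -scalemxAl mxE. Qed.

Lemma qform_scalar n c (x : 'cV[R]_n) : qform c%:M x = c * sqnorm x.
Proof. by rewrite /qform mul_mx_scalar -scalemxAl mxE. Qed.

Lemma qform_sum n (I : Type) (r : seq I) (F : I -> 'M[R]_n) x :
  qform (\sum_(i <- r) F i) x = \sum_(i <- r) qform (F i) x.
Proof.
elim/big_rec2: _ => [|i a b _ <-]; last exact: qformD.
by rewrite /qform mulmx0 mul0mx mxE.
Qed.

Lemma qform_congr m n (A : 'M[R]_(m, n)) B x :
  qform (A *m B *m A^T) x = qform B (A^T *m x).
Proof. by rewrite /qform trmx_mul trmxK !mulmxA. Qed.

Lemma psd_congr m n (A : 'M[R]_(m, n)) B : psd B -> psd (A *m B *m A^T).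
Proof.
move=> [sB pB]; split=> [|x]; last by rewrite qform_congr.
by rewrite !trmx_mul trmxK sB mulmxA.
Qed.

(** The form of A^-1 at x is that of A at A^-1 x; a singular A is its own
    [invmx]. *)
Lemma psd_invmx n (A : 'M[R]_n) : psd A -> psd (invmx A).
Proof.
case: (boolP (A \in unitmx)) => [uA|/invmx_out->//] [sA pA].
split=> [|x]; first by rewrite trmx_inv sA.
suff <- : qform A (invmx A *m x) = qform (invmx A) x by [].
by rewrite /qform trmx_mul trmx_inv sA -!mulmxA (mulmxA A) mulmxV // mul1mx.
Qed.

Lemma psd_ge n (a : R) (A : 'M[R]_n) : 0 <= a -> loewner_le a%:M A -> psd A.
Proof.
move=> a0 [sA pA]; split=> [|x].
  by move: sA; rewrite linearB /= tr_scalar_mx => /addIr.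
have := pA x; rewrite qformB qform_scalar subr_ge0; apply: le_trans.
by rewrite mulr_ge0 // sqnorm_ge0.
Qed.

(** The sum of the moduli of the entries serves as C, because
    |x_i x_j| <= |x|^2. *)
Lemma qform_bounded n (A : 'M[R]_n) :
  exists2 C : R, 0 <= C & forall x, qform A x <= C * sqnorm x.
Proof.
exists (\sum_i \sum_j `|A i j|) => [|x].
  by apply: sumr_ge0 => i _; apply: sumr_ge0.
have le i : `|x i 0| ^+ 2 <= sqnorm x.
  rewrite real_normK ?num_real // sqnormE (bigD1 i) //= lerDl.
  by rewrite sumr_ge0 // => j _; rewrite sqr_ge0.
rewrite mulr_suml /qform mxE.
under eq_bigr do rewrite mxE big_distrl /=.
rewrite exchange_big; apply: ler_sum => i _; rewrite mulr_suml.
apply: ler_sum => j _; rewrite mxE.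
apply: (le_trans (ler_norm _)); rewrite !normrM mulrAC mulrC.
apply: ler_wpM2l => //.
move: (sqr_ge0 (`|x i 0| - `|x j 0|)) (le i) (le j).
by rewrite sqrrB; lra.
Qed.

Lemma hformD n (A B : 'M[R]_n) x : hform (A + B) x = hform A x + hform B x.
Proof. by rewrite /hform /cplx_mx map_mxD mulmxDr mulmxDl mxE. Qed.

Lemma cplx_mx_conjT m n (A : 'M[R]_(m, n)) : (cplx_mx A)^t* = cplx_mx A^T.
Proof.
by apply/matrixP => i j; rewrite !mxE conj_Creal // complex_real.
Qed.

Lemma hform_congr m n (A : 'M[R]_(m, n)) B x :
  hform (A *m B *m A^T) x = hform B (cplx_mx A^T *m x).
Proof.
rewrite /hform trmx_mul map_mxM cplx_mx_conjT trmxK /cplx_mx !map_mxM.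
by rewrite !mulmxA.
Qed.

Lemma conjT_scale m n (c : R[i]) (A : 'M[R[i]]_(m, n)) :
  (c *: A)^t* = c^* *: A^t*.
Proof. by apply/matrixP => i j; rewrite !mxE rmorphM. Qed.

Lemma hformZ n (A : 'M[R]_n) (c : R[i]) x :
  hform A (c *: x) = `|c| ^+ 2 * hform A x.
Proof.
rewrite /hform conjT_scale -!scalemxAl -scalemxAr !mxE normCK.
by rewrite mulrA [c * _]mulrC.
Qed.

Lemma hform_real n (A : 'M[R]_n) (x : 'cV[R]_n) :
  hform A (cplx_mx x) = (qform A x)%:C.
Proof.
by rewrite /hform cplx_mx_conjT /cplx_mx -!map_mxM mxE.
Qed.

(** Writing u = a + 'i b with a and b real, the cross terms cancel by symmetry
    of A, which leaves the sum of the real forms at a and b. *)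
Lemma hform_psd n (A : 'M[R]_n) u : psd A -> 0 <= hform A u.
Proof.
move=> [sA pA].
pose a : 'cV[R]_n := \col_i complex.Re ('Re (u i 0)).
pose b : 'cV[R]_n := \col_i complex.Re ('Im (u i 0)).
have uE : u = cplx_mx a + 'i *: cplx_mx b.
  apply/matrixP => i j; rewrite ord1 !mxE !RRe_real ?Creal_Re ?Creal_Im //.
  exact: Crect.
have uTE : u ^t* = cplx_mx a^T - 'i *: cplx_mx b^T.
  by rewrite uE linearD /= map_mxD conjT_scale conjCi !cplx_mx_conjT scaleNr.
have cross : a^T *m A *m b = b^T *m A *m a.
  rewrite [LHS]mx11_scalar -tr_scalar_mx -mx11_scalar !trmx_mul trmxK sA.
  by rewrite mulmxA.
have -> : hform A u = (qform A a + qform A b)%:C; last first.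
  by rewrite ler0c addr_ge0.
rewrite /hform uTE uE !(mulmxDl, mulmxDr, mulNmx, mulmxN) -?scalemxAl.
rewrite -?scalemxAr /cplx_mx -!map_mxM cross scalerA -expr2 sqrCi.
rewrite scaleN1r /qform rmorphD /= !mxE; ring.
Qed.

End Forms.

(** * Spectral bounds on the resolvent *)

Section Spectral.
Variable R : realType.

(** A real symmetric matrix is Hermitian over R[i], hence unitarily
    diagonalizable with real eigenvalues. These are nonnegative because the
    form is, so that they are also singular values: a row of U is an
    eigenvector of S for d and therefore of S^T S = S^2 for d^2. *)
Lemma psd_spectral n (S : 'M[R]_n) : psd S ->
  exists (U : 'M[R[i]]_n) (d : 'I_n -> R),
    [/\ U \is unitarymx,
        cplx_mx S = U^t* *m diag_mx (\row_i (d i)%:C) *m U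
      & forall i, singular_values S (d i)].
Proof.
move=> pS; have [sS _] := pS.
have real_S : cplx_mx S \is a mxOver Num.real.
  by apply/mxOverP => i j; rewrite mxE complex_real.
have herm_S : cplx_mx S \is hermsymmx.
  apply: realsym_hermsym => //.
  apply/eqP; rewrite expr0 scale1r; apply/matrixP => i j.
  by rewrite !mxE /= -{1}sS mxE.
have /orthomx_spectralP SE := hermitian_normalmx herm_S.
move: SE (spectral_unitarymx (cplx_mx S)) (hermitian_spectral_diag_real herm_S).
move: (spectralmx _) (spectral_diag _) => U D SE uU /mxOverP rD.
have DE : D = \row_i (complex.Re (D 0 i))%:C.
  by apply/rowP => i; rewrite mxE RRe_real.
exists U, (fun i => complex.Re (D 0 i)); split=> //.
  by rewrite -DE -invmx_unitary.
move=> i; set d := complex.Re _.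
have dE : D 0 i = d%:C by rewrite /d RRe_real.
have rowU : row i U *m cplx_mx S = d%:C *: row i U.
  rewrite SE !mulmxA -row_mul mulmxV ?unitarymx_unit // row1 -rowE.
  by rewrite row_diag_mx dE -scalemxAl -rowE.
have Uii : (row i U *m (row i U)^t*) 0 0 = 1.
  have /unitarymxP/matrixP/(_ i i) := uU.
  rewrite !mxE eqxx => h; apply: etrans h.
  by apply: eq_bigr => j _; rewrite !mxE.
split.
  have := hform_psd ((row i U)^t*) pS; rewrite /hform.
  have -> : (row i U)^t*^t* = row i U.
    by apply/matrixP => k l; rewrite !mxE conjCK.
  by rewrite rowU -scalemxAl mxE Uii mulr1 ler0c.
rewrite -(eigenvalue_map (real_complex R)); apply/eigenvalueP; exists (row i U).
  rewrite sS map_mxM mulmxA rowU -scalemxAl rowU scalerA.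
  by rewrite /= rmorphXn expr2.
apply: contraPneq Uii => ->; rewrite mul0mx mxE => /esym/eqP.
by rewrite oner_eq0.
Qed.

(** [sup] takes a junk value on an unbounded set, so that [sigma_max] bounds the
    singular values only once they are known to be bounded. Evaluating the form
    of A^T A at an eigenvector bounds s^2. *)
Lemma singular_values_bounded n (A : 'M[R]_n) : has_ubound (singular_values A).
Proof.
have [C C0 hC] := qform_bounded (A^T *m A).
exists (C + 1) => s [s0 /eigenvalueP[v vE v0]].
have v0' : v^T != 0 by rewrite trmx_eq0.
have := hC v^T; rewrite {1}/qform trmxK vE -scalemxAl mxE.
rewrite -[v in v *m _]trmxK -/(sqnorm v^T) ler_pM2r ?sqnorm_gt0 //.
by nra.
Qed.

Lemma sigma_min_ge0 n (A : 'M[R]_n) : 0 <= sigma_min A.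
Proof.
rewrite /sigma_min; have [->|/set0P e] := eqVneq (singular_values A) set0.
  by rewrite inf0.
by apply: lb_le_inf => // s [].
Qed.

Lemma sigma_max_ge0 n (A : 'M[R]_n) : 0 <= sigma_max A.
Proof.
rewrite /sigma_max; have [->|/set0P[s hs]] := eqVneq (singular_values A) set0.
  by rewrite sup0.
apply: (@le_trans _ _ s); first by case: hs.
by apply: ub_le_sup hs; exact: singular_values_bounded.
Qed.

Lemma sigma_bounds n (A : 'M[R]_n) s : singular_values A s ->
  sigma_min A <= s <= sigma_max A.
Proof.
move=> hs; rewrite ge_inf ?ub_le_sup //; first exact: singular_values_bounded.
by exists 0 => t [].
Qed.

Lemma hform_diag n (A : 'M[R]_n) (U : 'M[R[i]]_n) (D : 'rV[R[i]]_n) u :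
  cplx_mx A = U^t* *m diag_mx D *m U ->
  hform A u = \sum_i D 0 i * `|(U *m u) i 0| ^+ 2.
Proof.
move=> AE; rewrite /hform AE.
have -> : u^t* *m (U^t* *m diag_mx D *m U) *m u
  = (U *m u)^t* *m (diag_mx D *m (U *m u)).
  by rewrite trmx_mul map_mxM !mulmxA.
rewrite mul_diag_mx mxE; apply: eq_bigr => i _.
rewrite [X in _ * X = _]mxE [X in X * _ = _]mxE mxE normCK.
by rewrite mulrCA [_^* * _]mulrC.
Qed.

(** In an orthonormal eigenbasis of S the three forms are sums of
    |(U u)_i|^2 with weights 1 / (1 + sigma_max), 1 / (1 + d_i) and
    1 / (1 + sigma_min). *)
Lemma hform_resolvent n (S : 'M[R]_n) u : psd S ->
  hform 1%:M u / (1 + sigma_max S)%:C <= hform (invmx (1%:M + S)) u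
    <= hform 1%:M u / (1 + sigma_min S)%:C.
Proof.
move=> /psd_spectral[U [d [uU SE dS]]].
have d0 i : 0 <= d i by case: (dS i).
have /unitarymxP UUt := uU; have UU := mulmx1C UUt.
have oneE : cplx_mx (1%:M : 'M[R]_n) = U^t* *m diag_mx (\row_i (1 : R)%:C) *m U.
  rewrite /cplx_mx map_mx1 (_ : diag_mx _ = 1%:M) ?mulmx1 ?UU //.
  by rewrite -diag_const_mx; congr diag_mx; apply/rowP => i; rewrite !mxE.
pose e := \row_i ((1 + d i)^-1)%:C.
have invE : cplx_mx (invmx (1%:M + S)) = U^t* *m diag_mx e *m U.
  have h : cplx_mx (1%:M + S) *m (U^t* *m diag_mx e *m U) = 1%:M.
    rewrite /cplx_mx map_mxD -/(cplx_mx _) -/(cplx_mx S) oneE SE.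
    rewrite -mulmxDl -mulmxDr -raddfD /=.
    rewrite !mulmxA -(mulmxA _ U) UUt mulmx1.
    rewrite -(mulmxA _ (diag_mx _) (diag_mx _)) mulmx_diag.
    rewrite (_ : diag_mx _ = 1%:M) ?mulmx1 ?UU //.
    rewrite -diag_const_mx; congr diag_mx; apply/rowP => i; rewrite !mxE.
    by rewrite -rmorphD -rmorphM divff // lt0r_neq0 // ltr_pwDl.
  have [u1 _] := mulmx1_unit h.
  rewrite /cplx_mx map_invmx -[RHS](mulKmx u1) -/(cplx_mx _) h mulmx1 //.
rewrite (hform_diag _ invE) (hform_diag _ oneE) !mulr_suml.
apply/andP; split; apply: ler_sum => i _; rewrite !mxE mul1r mulrC.
  rewrite ler_wpM2r ?exprn_ge0 // -fmorphV lecR lef_pV2 ?posrE.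
  - by have /andP[_] := sigma_bounds (dS i); rewrite lerD2l.
  - by rewrite ltr_pwDl ?sigma_max_ge0.
  - by rewrite ltr_pwDl.
rewrite ler_wpM2l ?exprn_ge0 // -fmorphV lecR lef_pV2 ?posrE.
- by have /andP[+ _] := sigma_bounds (dS i); rewrite lerD2l.
- by rewrite ltr_pwDl.
- by rewrite ltr_pwDl ?sigma_min_ge0.
Qed.

End Spectral.

(** * The Riccati equation as a pair of affine inequalities *)

Section Riccati.
Variable R : realType.

Lemma precision_psd n d (H : 'M[R]_(d, n)) Rv : psd Rv -> psd (precision H Rv).
Proof.
move=> /psd_invmx /(psd_congr H^T); rewrite /precision trmxK; exact.
Qed.

(** The form of M X (1 + S)^-1 X^T M^T at u is that of (1 + S)^-1 at
    X^T M^T u, and the squared norm of X^T M^T u is the form of P = X X^T at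
    M^T u. *)
Lemma riccati_bounds n (M Om Q X P : 'M[R]_n) u :
  psd Om -> stable_riccati M Om Q X P ->
  hform P (cplx_mx M^T *m u) / (1 + sigma_max (X^T *m Om *m X))%:C + hform Q u
    <= hform P u
    <= hform P (cplx_mx M^T *m u) / (1 + sigma_min (X^T *m Om *m X))%:C
       + hform Q u.
Proof.
move=> pOm [PX PE]; set S := X^T *m Om *m X.
have pS : psd S by have := psd_congr X^T pOm; rewrite trmxK.
have PE' : P = M *m (X *m invmx (1%:M + S) *m X^T) *m M^T + Q.
  by rewrite {1}PE !mulmxA.
have -> : hform P u =
    hform (invmx (1%:M + S)) (cplx_mx X^T *m (cplx_mx M^T *m u)) + hform Q u.
  by rewrite {1}PE' hformD !hform_congr.
have -> : hform P (cplx_mx M^T *m u) =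
    hform 1%:M (cplx_mx X^T *m (cplx_mx M^T *m u)).
  by rewrite -(hform_congr X 1%:M) mulmx1 -PX.
by rewrite !lerD2r hform_resolvent.
Qed.

Lemma riccati_bounds_real n (M Om Q X P : 'M[R]_n) x :
  psd Om -> stable_riccati M Om Q X P ->
  (1 + sigma_max (X^T *m Om *m X))^-1 * qform P (M^T *m x) + qform Q x
    <= qform P x
    <= (1 + sigma_min (X^T *m Om *m X))^-1 * qform P (M^T *m x) + qform Q x.
Proof.
move=> pOm ric; have := riccati_bounds (cplx_mx x) pOm ric.
rewrite -[cplx_mx M^T *m _]map_mxM -/(cplx_mx _) !hform_real.
by rewrite -!fmorphV -!rmorphM -!rmorphD /= !lecR ![_^-1 * _]mulrC.
Qed.

Lemma riccati_psd n (M Om Q X P : 'M[R]_n) : stable_riccati M Om Q X P -> psd P.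
Proof.
case=> -> _; split; first by rewrite trmx_mul trmxK.
move=> x; rewrite /qform mulmxA -mulmxA -[x^T *m X]trmxK trmx_mul trmxK.
exact: sqnorm_ge0.
Qed.

Lemma trmx_exp n (M : 'M[R]_n) m : (M ^+ m)^T = M^T ^+ m.
Proof.
elim: m => [|m IH]; first by rewrite !expr0 trmx1.
by rewrite exprS exprSr trmx_mul IH.
Qed.

(** The reindexing m = N - l makes the exponents increase with the index. *)
Lemma weighted_controllabilityE n (M Q : 'M[R]_n) g N x :
  qform (weighted_controllability M Q g N 0) x =
  \sum_(m < N.+1) (1 + g)^-1 ^+ m * qform Q (M^T ^+ m *m x).
Proof.
rewrite /weighted_controllability big_nat_rev big_mkord qform_sum.
apply: eq_bigr => m _; rewrite qformZ qform_congr add0n subSS div1r.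
by rewrite subKn -1?ltnS // trmx_exp.
Qed.

Lemma affine_upper (s : R) (P Q : R[i]) :
  P <= s%:C * P + Q -> s < 1 -> P <= Q / (1 - s)%:C.
Proof.
move=> h s1; rewrite ler_pdivlMr ?ltcR ?subr_gt0 //.
by rewrite rmorphB rmorph1 mulrBr mulr1 mulrC lerBlDl.
Qed.

(** For s >= 1 the left-hand side is nonpositive, also at s = 1, where the
    inverse of 0 is 0. *)
Lemma affine_lower (s : R) (P Q : R[i]) : 0 <= P -> 0 <= Q ->
  s%:C * P + Q <= P -> Q / (1 - s)%:C <= P.
Proof.
move=> P0 Q0 h; have [s1|s1] := ltP s 1.
  rewrite ler_pdivrMr ?ltcR ?subr_gt0 //.
  by rewrite rmorphB rmorph1 mulrBr mulr1 mulrC lerBrDl.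
apply: le_trans P0; rewrite mulr_ge0_le0 // -fmorphV lecR invr_le0.
by rewrite subr_le0.
Qed.

End Riccati.

(** * Iteration and geometric series *)

Section Iteration.
Variable R : realType.

Lemma affine_iter_ge n (A : 'M[R]_n) (f g : 'cV[R]_n -> R) c (c0 : 0 <= c) :
  (forall x, c * f (A *m x) + g x <= f x) ->
  forall K x, \sum_(m < K) c ^+ m * g (A ^+ m *m x)
              + c ^+ K * f (A ^+ K *m x) <= f x.
Proof.
move=> h; elim=> [|K IH] x; first by rewrite big_ord0 add0r !expr0 mul1r mul1mx.
apply: le_trans (IH x); rewrite big_ord_recr /= -addrA lerD2l addrC.
have := ler_wpM2l (exprn_ge0 K c0) (h (A ^+ K *m x)).
by rewrite mulrDr mulrA -exprSr mulmxA -[A *m _]exprS.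
Qed.

Lemma affine_iter_le n (A : 'M[R]_n) (f g : 'cV[R]_n -> R) c (c0 : 0 <= c) :
  (forall x, f x <= c * f (A *m x) + g x) ->
  forall K x, f x <= \sum_(m < K) c ^+ m * g (A ^+ m *m x)
              + c ^+ K * f (A ^+ K *m x).
Proof.
move=> h K x.
have := @affine_iter_ge n A (fun x => - f x) (fun x => - g x) c c0 _ K x.
rewrite mulrN lerNr opprD opprK -sumrN.
under eq_bigr do rewrite mulrN opprK.
by apply=> y; rewrite mulrN -opprD lerN2.
Qed.

(** Pass to the limit in K. *)
Lemma le0_geometric_bound (a b r : R) :
  0 <= r < 1 -> (forall K, a <= b * r ^+ K) -> a <= 0.
Proof.
move=> /andP[r0 r1] h; have nr1 : `|r| < 1 by rewrite ger0_norm.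
by apply: (cvgr_to_ge (cvg_geometric b nr1)); apply: nearW.
Qed.

Lemma geometric_sum (r : R) K : r != 1 ->
  \sum_(k < K) r ^+ k = (1 - r ^+ K) / (1 - r).
Proof.
move=> r1; have r1' : 1 - r != 0 by rewrite subr_eq0 eq_sym.
apply: (canRL (mulfK r1')).
by rewrite -(opprB r) -[RHS]opprB subrX1 mulrN mulrC.
Qed.

(** Multiplying the bounds on the mean logarithmic growth by 2 m and
    exponentiating. The vector must not vanish, since [ln 0] carries no
    information; this is where M has to be invertible. *)
Lemma growth_thresholdP n (M : 'M[R]_n) k (b : 'I_k -> 'cV[R]_n) lam eps N j m :
  M \in unitmx -> b j != 0 -> growth_threshold M b lam eps N -> (N < m)%N ->
  expR (2 * (lam - eps)) ^+ m <= sqnorm (M^T ^+ m *m b j)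
    <= expR (2 * (lam + eps)) ^+ m.
Proof.
move=> uM b0 hN lt; have := hN j m lt.
have m0 : 0 < m%:R :> R by rewrite ltr0n (leq_ltn_trans _ lt).
have x0 : M^T ^+ m *m b j != 0.
  elim: m {lt m0} => [|m IH]; first by rewrite expr0 mul1mx.
  apply: contra IH => /eqP h; rewrite -[_ *m _](mulKmx (_ : M^T \in unitmx)).
    by rewrite (mulmxA M^T) -[M^T *m _]exprS h mulmx0.
  by rewrite unitmx_tr.
have s0 := sqnorm_gt0 x0; rewrite -/(sqnorm _) in s0 *.
have e0 : 0 < euclidean_norm (M^T ^+ m *m b j) by rewrite sqrtr_gt0.
have -> : sqnorm (M^T ^+ m *m b j) =
    expR (2 * ln (euclidean_norm (M^T ^+ m *m b j))).
  by rewrite expRM_natl lnK ?posrE // sqr_sqrtr // ltW.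
rewrite -!expRM_natl !ler_expR mul1r.
set L := ln _; move=> /andP[]; rewrite ltrBrDl ltrBlDl.
have : L = m%:R * (m%:R^-1 * L) by rewrite mulVKf ?lt0r_neq0.
move: (_^-1 * L) => q -> h1 h2.
by rewrite ![_ * (2 * _)]mulrCA !ler_pM2l //; lra.
Qed.

(** The constant C comes from [qform_bounded] and bounds the remainder by
    C r^(N+1) r^K. *)
Lemma geometric_iter_upper n (A P Q : 'M[R]_n) c e q N x :
  0 <= c -> 0 <= e -> 0 <= q -> c * e < 1 ->
  (forall y, qform P y <= c * qform P (A *m y) + qform Q y) ->
  (forall y, qform Q y <= q * sqnorm y) ->
  (forall m, (N < m)%N -> sqnorm (A ^+ m *m x) <= e ^+ m) ->
  qform P x <= \sum_(m < N.+1) c ^+ m * qform Q (A ^+ m *m x)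
     + (c * e) ^+ N.+1 * (q / (1 - c * e)).
Proof.
move=> c0 e0 q0 r1 hP hQ hx; set r := c * e.
have r0 : 0 <= r by rewrite mulr_ge0.
have [C C0 hC] := qform_bounded P.
rewrite -subr_le0; apply: (@le0_geometric_bound _ (C * r ^+ N.+1) r).
  by rewrite r0.
move=> K.
have := affine_iter_le c0 hP (N.+1 + K) x; rewrite big_split_ord /=.
have tail : \sum_(k < K) c ^+ (N.+1 + k) * qform Q (A ^+ (N.+1 + k) *m x)
    <= r ^+ N.+1 * (q / (1 - r)).
  apply: (@le_trans _ _ (\sum_(k < K) (r ^+ N.+1 * q) * r ^+ k)).
    apply: ler_sum => k _; rewrite mulrAC -exprD exprMn -mulrA.
    rewrite ler_wpM2l ?exprn_ge0 // mulrC; apply: le_trans (hQ _) _.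
    by rewrite ler_wpM2l // hx // ltnS leq_addr.
  rewrite -mulr_sumr geometric_sum ?lt_eqF // -mulrA.
  rewrite ler_wpM2l ?exprn_ge0 // ler_wpM2l //.
  rewrite -[leRHS]mul1r ler_wpM2r ?invr_ge0 ?subr_ge0 ?(ltW r1) //.
  by rewrite gerBl exprn_ge0.
have rest : c ^+ (N.+1 + K) * qform P (A ^+ (N.+1 + K) *m x)
    <= C * r ^+ N.+1 * r ^+ K.
  rewrite -mulrA -exprD exprMn mulrCA ler_wpM2l ?exprn_ge0 //.
  apply: le_trans (hC _) _; rewrite ler_wpM2l // hx // ltnS leq_addr //.
by move: tail rest; lra.
Qed.

(** The partial sums [part] give the claim by letting K tend to infinity if
    r < 1, and already at K = 0 if r >= 1, as q / (1 - r) <= 0 then. *)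
Lemma geometric_iter_lower n (A P Q : 'M[R]_n) c e q N x :
  0 <= c -> 0 <= e -> 0 <= q ->
  (forall y, 0 <= qform P y) ->
  (forall y, c * qform P (A *m y) + qform Q y <= qform P y) ->
  (forall y, q * sqnorm y <= qform Q y) ->
  (forall m, (N < m)%N -> e ^+ m <= sqnorm (A ^+ m *m x)) ->
  \sum_(m < N.+1) c ^+ m * qform Q (A ^+ m *m x)
     + (c * e) ^+ N.+1 * (q / (1 - c * e)) <= qform P x.
Proof.
move=> c0 e0 q0 pP hP hQ hx; set r := c * e.
have r0 : 0 <= r by rewrite mulr_ge0.
have part K : \sum_(m < N.+1) c ^+ m * qform Q (A ^+ m *m x)
    + r ^+ N.+1 * q * (\sum_(k < K) r ^+ k) <= qform P x.
  apply: le_trans (affine_iter_ge c0 hP (N.+1 + K) x); rewrite big_split_ord /=.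
  rewrite -addrA lerD2l mulr_sumr -[leLHS]addr0 lerD //; last first.
    by rewrite mulr_ge0 ?exprn_ge0.
  apply: ler_sum => k _; rewrite mulrAC -exprD exprMn -mulrA.
  rewrite ler_wpM2l ?exprn_ge0 // mulrC; apply: le_trans (hQ _).
  by rewrite ler_wpM2l // hx // ltnS leq_addr.
have [r1|r1] := ltP r 1; last first.
  apply: le_trans (part 0%N); rewrite big_ord0 mulr0 lerD2l.
  rewrite mulr_ge0_le0 ?exprn_ge0 // mulr_ge0_le0 // invr_le0 subr_le0 //.
rewrite -subr_le0.
apply: (@le0_geometric_bound _ (r ^+ N.+1 * (q / (1 - r))) r).
  by rewrite r0.
move=> K; have := part K; rewrite geometric_sum ?lt_eqF // mulrBl mul1r.
by rewrite !mulrA mulrAC; lra.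
Qed.

End Iteration.

(** * Bounds on the stationary covariance *)

Theorem proposition1 (R : realType) (n d : nat) (hn : (0 < n)%N)
    (hd : (d <= n)%N)
    (M : 'M[R]_n) (H : 'M[R]_(d, n)) (Q : 'M[R]_n) (Rv : 'M[R]_d)
    (hM : M \in unitmx)
    (qinf qsup rinf rsup : R)
    (hqinf : 0 <= qinf) (hQinf : loewner_le qinf%:M Q)
    (hQsup : loewner_le Q qsup%:M)
    (hrinf : 0 < rinf) (hRinf : loewner_le rinf%:M Rv)
    (hRsup : loewner_le Rv rsup%:M)
    (disp : measure_display) (T : measurableType disp) (Pr : probability T R)
    (x w : nat -> T -> 'cV[R]_n) (y v : nat -> T -> 'cV[R]_d)
    (hsys : linear_gaussian_system Pr M H Q Rv x w y v)
    (Om : 'M[R]_n) (hOm : Om = precision H Rv)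
    (hobs : uniformly_completely_observable M Om)
    (hctr : uniformly_completely_controllable M Q)
    (Xhat Phat : 'M[R]_n) (hric : stable_riccati M Om Q Xhat Phat)
    (alpha beta : R)
    (halpha : alpha = sigma_min (Xhat^T *m Om *m Xhat))
    (hbeta : beta = sigma_max (Xhat^T *m Om *m Xhat))
    (p : nat) (lam : 'I_p -> R) (kappa : 'I_p -> nat)
    (hspec : lyapunov_spectrum M lam kappa)
    (B : forall i : 'I_p, 'I_(kappa i) -> 'cV[R]_n)
    (hB : backward_lyapunov_vectors M lam B) :
  (forall (i : 'I_p) (eps : R), 0 < eps ->
     expR (2 * (lam i + eps)) / (1 + alpha) < 1 ->
     (forall (mu : R[i]) (u : 'cV[R[i]]_n),
        col_eigenvector M^T mu u -> `|mu| = (expR (lam i))%:C ->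
        hform Phat u
          <= hform Q u / (1 - expR (2 * lam i) / (1 + alpha))%:C) /\
     (forall N : nat, growth_threshold M (B i) (lam i) eps N ->
        forall j : 'I_(kappa i),
        qform Phat (B i j)
          <= qform (weighted_controllability M Q alpha N 0) (B i j)
             + (expR (2 * (lam i + eps)) / (1 + alpha)) ^+ N.+1
               * (qsup / (1 - expR (2 * (lam i + eps)) / (1 + alpha)))))
  /\
  (forall i : 'I_p,
     (forall (mu : R[i]) (u : 'cV[R[i]]_n),
        col_eigenvector M^T mu u -> `|mu| = (expR (lam i))%:C ->
        hform Q u / (1 - expR (2 * lam i) / (1 + beta))%:C
          <= hform Phat u) /\
     (forall (eps : R) (N : nat), 0 < eps ->
        growth_threshold M (B i) (lam i) eps N ->
        forall j : 'I_(kappa i),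
        qform (weighted_controllability M Q beta N 0) (B i j)
          + (expR (2 * (lam i - eps)) / (1 + beta)) ^+ N.+1
            * (qinf / (1 - expR (2 * (lam i - eps)) / (1 + beta)))
          <= qform Phat (B i j))).
Proof.
have pR : psd Rv by apply: psd_ge hRinf; exact: ltW.
have pOm : psd Om by rewrite hOm; exact: precision_psd.
have pQ : psd Q by exact: psd_ge hQinf.
have pP := riccati_psd hric.
have sup_Q z : qform Q z <= qsup * sqnorm z.
  by have [_ /(_ z)] := hQsup; rewrite qformB qform_scalar subr_ge0.
have inf_Q z : qinf * sqnorm z <= qform Q z.
  by have [_ /(_ z)] := hQinf; rewrite qformB qform_scalar subr_ge0.
have a0 : 0 < 1 + alpha by rewrite halpha ltr_pwDl ?sigma_min_ge0.
have b0 : 0 < 1 + beta by rewrite hbeta ltr_pwDl ?sigma_max_ge0.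
have B1 i j : sqnorm (B i j) = 1.
  pose a := Tagged (fun i => 'I_(kappa i)) j.
  by have [/(_ a a) + _] := hB; rewrite eqxx.
have B0 i j : B i j != 0.
  apply: contra_eq_neq (B1 i j) => ->.
  by rewrite /sqnorm mulmx0 mxE eq_sym oner_eq0.
(* An index j is what provides a unit vector on which to evaluate Q <= qsup. *)
have qsup0 i (j : 'I_(kappa i)) : 0 <= qsup.
  have := sup_Q (B i j); rewrite B1 mulr1; apply: le_trans.
  by case: pQ.
have eig i mu u : col_eigenvector M^T mu u -> `|mu| = (expR (lam i))%:C ->
    hform Phat (cplx_mx M^T *m u) = (expR (2 * lam i))%:C * hform Phat u.
  by move=> [_ ->] hmu; rewrite hformZ hmu -rmorphXn /= -expRM_natl.
split=> [i eps eps0 lt1|i]; split.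
- move=> mu u hu hmu; have /andP[_] := riccati_bounds u pOm hric.
  rewrite -halpha (eig _ _ _ hu hmu) mulrAC -fmorphV -rmorphM /= => h.
  apply: affine_upper => //.
  apply: le_lt_trans lt1; rewrite ler_pM2r ?invr_gt0 // ler_expR.
  by rewrite ler_pM2l // lerDl ltW.
- move=> N hN j; rewrite weighted_controllabilityE [_ / (1 + alpha)]mulrC.
  apply: geometric_iter_upper => //.
  + by rewrite invr_ge0 ltW.
  + exact: qsup0 j.
  + by rewrite mulrC.
  + move=> z; have /andP[_] := riccati_bounds_real z pOm hric.
    by rewrite halpha.
  + by move=> m lt; have /andP[] := growth_thresholdP hM (B0 i j) hN lt.
- move=> mu u hu hmu; have /andP[+ _] := riccati_bounds u pOm hric.
  rewrite -hbeta (eig _ _ _ hu hmu) mulrAC -fmorphV -rmorphM /= => h.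
  by apply: affine_lower => //; exact: hform_psd.
- move=> eps N eps0 hN j.
  rewrite weighted_controllabilityE [_ / (1 + beta)]mulrC.
  apply: geometric_iter_lower => //.
  + by rewrite invr_ge0 ltW.
  + by case: pP.
  + move=> z; have /andP[+ _] := riccati_bounds_real z pOm hric.
    by rewrite hbeta.
  + by move=> m lt; have /andP[] := growth_thresholdP hM (B0 i j) hN lt.
Qed.
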